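(* Let $m\geq 2$ be an integer, let $G$ be a $T_{1}$ $m$-semitopological group, and let $H$ be a compact closed normal subgroup of $G$. Then the quotient group $G/H$ (with the quotient topology) is an $(m-1)$-semitopological group.
   Context: A semitopological group is a group with a topology making multiplication separately continuous. For $n\in\mathbb{N}$ (positive integers), a semitopological group $G$ with neutral element $e$ is an $n$-semitopological group if for every $g\in G$ with $e\notin\overline{\{g\}}$ there is a neighborhood $W$ of $e$ with $g\notin W^{n}$, where $W^n=\{w_1\cdots w_n:w_i\in W\}$. *)

(* Defs.v *)
From HB Require Import structures.
From mathcomp Require Import all_boot.
From mathcomp Require Import boolp classical_sets topology.

Set Implicit Arguments.
Unset Strict Implicit.
Unset Printing Implicit Defensive.

Local Open Scope classical_set_scope.
Local Open Scope group_scope.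
Local Open Scope quotient_scope.

(* A group and a topology on the same carrier, with no compatibility required. *)
#[short(type="preTopologicalGroupType")]
HB.structure Definition PreTopologicalGroup :=
  {G of Group G & Topological G}.

Definition semitopological_group (G : preTopologicalGroupType) : Prop :=
  forall g : G,
    continuous (fun x : G => g * x) /\ continuous (fun x : G => x * g).

Definition set_power (G : groupType) (W : set G) (n : nat) : set G :=
  [set g | exists w : 'I_n -> G,
     (forall i, W (w i)) /\ g = \prod_(i < n) w i].

(* Intended for n >= 1 only; set_power W 0 is [set 1]. *)
Definition n_semitopological_group (n : nat) (G : preTopologicalGroupType) :
    Prop :=
  semitopological_group G /\
  forall g : G, ~ closure [set g] 1 ->
    exists W : set G, nbhs 1 W /\ ~ set_power W n g.

Record normalSubgroup (G : groupType) := NormalSubgroup {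
  normal_set :> set G;
  normal_group_closed : group_closed [in normal_set];
  normal_conj : forall h g : G, normal_set h -> normal_set (h ^ g)
}.

Section NormalSubgroupTheory.
Variables (G : groupType) (H : normalSubgroup G).

Lemma normal1 : normal_set H 1.
Proof. by have [/set_mem] := normal_group_closed H. Qed.

Lemma normalV x : normal_set H x -> normal_set H x^-1.
Proof.
move=> Hx; apply/set_mem; apply: (group_closedV (normal_group_closed H)).
exact: mem_set.
Qed.

Lemma normalM x y : normal_set H x -> normal_set H y -> normal_set H (x * y).
Proof.
move=> Hx Hy; apply/set_mem; apply: (group_closedM (normal_group_closed H));
  exact: mem_set.
Qed.

(* Left cosets: x and y are related iff x H = y H. *)
Definition coset_rel : rel G := fun x y => `[< normal_set H (x^-1 * y) >].

Lemma coset_rel_refl : reflexive coset_rel.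
Proof. by move=> x; apply/asboolP; rewrite mulVg; exact: normal1. Qed.

Lemma coset_rel_sym : symmetric coset_rel.
Proof.
suff imp x y : coset_rel x y -> coset_rel y x.
  by move=> x y; apply/idP/idP; exact: imp.
by move=> /asboolP /normalV h; apply/asboolP; rewrite invgM invgK in h.
Qed.

Lemma coset_rel_trans : transitive coset_rel.
Proof.
move=> y x z /asboolP xy /asboolP yz; apply/asboolP.
by have := normalM xy yz; rewrite -mulgA mulVKg.
Qed.

Definition coset_equiv : equiv_rel G :=
  EquivRel coset_rel coset_rel_refl coset_rel_sym coset_rel_trans.

End NormalSubgroupTheory.

(* G / H; the topology is the final one for the projection \pi. *)
Definition quotient_group (G : preTopologicalGroupType) (H : normalSubgroup G) :
    Type :=
  quotient_topology {eq_quot coset_equiv H}.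

Section QuotientGroup.
Variables (G : preTopologicalGroupType) (H : normalSubgroup G).
Local Notation Q := (quotient_group H).

HB.instance Definition _ :=
  Topological.copy Q (quotient_topology {eq_quot coset_equiv H}).
HB.instance Definition _ :=
  Quotient.copy Q (quotient_topology {eq_quot coset_equiv H}).

Lemma quotient_groupP (x y : G) :
  \pi_Q x = \pi_Q y <-> normal_set H (x^-1 * y).
Proof.
split=> [xy|Hxy].
  by apply/(asboolP (normal_set H _)); apply/(@eqmodP _ (coset_equiv H)); exact: xy.
by apply/(@eqmodP _ (coset_equiv H)); apply/asboolP.
Qed.

Definition qone : Q := \pi_Q 1.
Definition qmul (a b : Q) : Q := \pi_Q (repr a * repr b).
Definition qinv (a : Q) : Q := \pi_Q (repr a)^-1.

Lemma qmul_pi (x y : G) : qmul (\pi_Q x) (\pi_Q y) = \pi_Q (x * y).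
Proof.
rewrite /qmul; apply/quotient_groupP.
have /quotient_groupP : \pi_Q (repr (\pi_Q x)) = \pi_Q x by rewrite reprK.
have /quotient_groupP : \pi_Q (repr (\pi_Q y)) = \pi_Q y by rewrite reprK.
move: (repr _) (repr _) => x' y' Hy Hx.
rewrite (_ : _^-1 * _ = (x'^-1 * x) ^ y' * (y'^-1 * y)).
  by apply: normalM => //; exact: normal_conj.
by rewrite /conjg invgM -!mulgA mulVKg.
Qed.

Lemma qinv_pi (x : G) : qinv (\pi_Q x) = \pi_Q x^-1.
Proof.
rewrite /qinv; apply/quotient_groupP.
have /quotient_groupP : \pi_Q x = \pi_Q (repr (\pi_Q x)) by rewrite reprK.
move: (repr _) => x' /(normal_conj x^-1).
by rewrite /conjg !invgK -mulgA mulVKg.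
Qed.

Lemma qmulA : associative qmul.
Proof.
move=> a b c; rewrite -[a]reprK -[b]reprK -[c]reprK.
by rewrite (qmul_pi (repr b)) (qmul_pi (repr a) (repr b)) !qmul_pi mulgA.
Qed.

Lemma qmul1 : left_id qone qmul.
Proof. by move=> a; rewrite -[a]reprK /qone qmul_pi mul1g. Qed.

Lemma qmulr1 : right_id qone qmul.
Proof. by move=> a; rewrite -[a]reprK /qone qmul_pi mulg1. Qed.

Lemma qmulV : left_inverse qone qinv qmul.
Proof. by move=> a; rewrite -[a]reprK qinv_pi qmul_pi mulVg. Qed.

Lemma qmulrV : right_inverse qone qinv qmul.
Proof. by move=> a; rewrite -[a]reprK qinv_pi qmul_pi mulgV. Qed.

HB.instance Definition _ := isGroup.Build Q qmulA qmul1 qmulr1 qmulV qmulrV.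

End QuotientGroup.

(* Main.v *)
(* If no neighborhood W of 1 keeps W^(m-1) away from the coset gH, the sets
   {k in H | g k^-1 in W^(m-1)} generate a proper filter on H, which has a
   cluster point k by compactness. Each W k is a neighborhood of k, so it
   contains some v k with v in W and g k^-1 v^-1 in W^(m-1); hence g k^-1 lies
   in W^m for every W, which forces g k^-1 = 1, i.e. g in H. Clustering along
   k^-1 rather than k is what avoids any use of continuity of the inverse. *)
Require Import Defs.
From mathcomp Require Import all_boot.
From mathcomp Require Import boolp classical_sets topology.

Set Implicit Arguments.
Unset Strict Implicit.
Unset Printing Implicit Defensive.

Local Open Scope classical_set_scope.
Local Open Scope group_scope.
Local Open Scope quotient_scope.

Lemma set_powerSr (G : groupType) (W : set G) n x y :
  set_power W n x -> W y -> set_power W n.+1 (x * y).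
Proof.
move=> [w [Ww ->]] Wy.
(* The word [w] is extended by [y] at the last index [ord_max]. *)
exists (fun i => if unlift ord_max i is Some j then w j else y); split.
  by move=> i; case: unliftP.
rewrite big_ord_recr /= unlift_none; congr (_ * _).
apply: eq_bigr => i _; have -> : widen_ord (leqnSn n) i = lift ord_max i.
  by apply: val_inj; rewrite /= /bump leqNgt ltn_ord.
by rewrite liftK.
Qed.

Lemma set_powerS (G : groupType) (V W : set G) n :
  V `<=` W -> set_power V n `<=` set_power W n.
Proof. by move=> VW x [w [Vw ->]]; exists w; split=> // i; exact: VW. Qed.

Lemma nbhs_mulr (G : preTopologicalGroupType) (k : G) (W : set G) :
  semitopological_group G -> nbhs 1 W -> nbhs k [set x | W (x * k^-1)].
Proof. by move=> Gst W1; apply: (Gst k^-1).2; rewrite /= mulgV. Qed.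

(** One of the [n.+1] factors is spent on passing from a point of [K] near the cluster point to that
    point itself; hence the drop in exponent. *)
Lemma compact_set_power_disjoint (n : nat) (G : preTopologicalGroupType)
    (K : set G) (g : G) :
  n_semitopological_group n.+1 G -> accessible_space G -> compact K ->
  ~ K g ->
  exists W : set G, nbhs 1 W /\ forall k, K k -> ~ set_power W n (g * k^-1).
Proof.
move=> [Gst Gsep] T1 cK Kg; apply: contrapT => noW.
pose B W := [set k | K k /\ set_power W n (g * k^-1)].
have BF : ProperFilter (filter_from (nbhs (1 : G)) B).
  apply: filter_from_proper; first apply: filter_from_filter.
  - by exists setT; exact: filterT.
  - move=> V W V1 W1; exists (V `&` W); first exact: filterI.
    by move=> k [Kk VWk]; split; split=> //; move: VWk; apply: set_powerS;
      [exact: subIsetl | exact: subIsetr].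
  - move=> W W1; apply: contrapT => BW0; apply: noW; exists W; split=> // k Kk Wk.
    by apply: BW0; exists k.
have [|k [Kk clk]] := cK _ BF.
  by exists setT; [exact: filterT | move=> k []].
have [|W [W1 Wgk]] := Gsep (g * k^-1).
  (* Singletons are closed, so [1] in the closure would give [g = k], against [~ K g]. *)
  move=> /(accessible_closed_set1 T1) /= /esym/divg1_eq gk.
  by apply: Kg; rewrite gk.
have [|h [[_ Wh] /= Whk]] := clk (B W) _ _ (nbhs_mulr k Gst W1).
  by exists W.
(* [g * k^-1] factors as [(g * h^-1) * (h * k^-1)]. *)
by apply: Wgk; have := set_powerSr Wh Whk; rewrite mulgA mulgVK.
Qed.

Section Quotient.
Variables (G : preTopologicalGroupType) (H : normalSubgroup G).
Local Notation Q := (quotient_group H).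

Lemma pi_mul (x y : G) : \pi_Q x * \pi_Q y = \pi_Q (x * y).
Proof. exact: qmul_pi. Qed.

Lemma pi_prod n (w : 'I_n -> G) :
  \prod_(i < n) \pi_Q (w i) = \pi_Q (\prod_(i < n) w i).
Proof.
by rewrite (big_morph (\pi_Q) (fun x y => esym (pi_mul x y)) erefl).
Qed.

(** Each factor is lifted to a chosen element of [W], and [\pi_Q] is multiplicative. *)
Lemma set_power_image_pi (W : set G) n :
  set_power (\pi_Q @` W) n `<=` \pi_Q @` set_power W n.
Proof.
move=> q [u [/(_ _)/cid2 Wu ->]].
exists (\prod_(i < n) s2val (Wu i)).
  by exists (fun i => s2val (Wu i)); split=> // i; exact: (s2valP (Wu i)).
by rewrite -pi_prod; apply: eq_bigr => i _; exact: (s2valP' (Wu i)).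
Qed.

Lemma quotient_group_semitopological :
  semitopological_group G -> semitopological_group Q.
Proof.
move=> Gst q; rewrite -[q]reprK; set g := repr q.
(* Continuity is tested after composing with [\pi_Q], where a translation of [Q] becomes [\pi_Q]
   after one of [G]. *)
split; apply/quotient_continuous.
  rewrite (_ : _ \o _ = \pi_Q \o (fun x => g * x)).
    move=> x; apply: continuous_comp; first exact: (Gst g).1.
    exact: pi_continuous.
  by apply/funext => x; exact: pi_mul.
rewrite (_ : _ \o _ = \pi_Q \o (fun x => x * g)).
  move=> x; apply: continuous_comp; first exact: (Gst g).2.
  exact: pi_continuous.
by apply/funext => x; exact: pi_mul.
Qed.

Lemma pi_open_map (U : set G) :
  semitopological_group G -> open U -> open (\pi_Q @` U : set Q).
Proof.
move=> Gst oU; change (open (\pi_Q @^-1` (\pi_Q @` U))).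
(* The saturation of [U] is a union of preimages of [U] under right translations, each open. *)
rewrite (_ : _ @^-1` _ = \bigcup_(h in (H : set G)) [set x | U (x * h)]).
  apply: bigcup_open => h _.
  by apply: (open_comp (f := fun x => x * h)) => // x _; exact: (Gst h).2.
apply/seteqP; split=> [x [u Uu /esym/quotient_groupP Hxu]|x [h Hh Uxh]].
  by exists (x^-1 * u) => //=; rewrite mulVKg.
exists (x * h) => //; apply/esym/quotient_groupP.
by rewrite mulKg.
Qed.

Lemma nbhs_image_pi (W : set G) :
  semitopological_group G -> nbhs 1 W -> nbhs (1 : Q) (\pi_Q @` W).
Proof.
move=> Gst W1; apply: (@filterS _ _ _ (\pi_Q @` interior W)).
  by apply: image_subset; exact: interior_subset.
apply: open_nbhs_nbhs; split; last by exists 1.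
exact: pi_open_map Gst (open_interior _).
Qed.

End Quotient.

Theorem theorem4p5 (m : nat) (G : preTopologicalGroupType)
    (H : normalSubgroup G) :
  (2 <= m)%N ->
  accessible_space G ->
  n_semitopological_group m G ->
  compact (H : set G) ->
  closed (H : set G) ->
  n_semitopological_group (m - 1) (quotient_group H).
Proof.
case: m => // n _ T1 Gn cH _; rewrite subn1 /=.
have Gst := Gn.1.
split=> [|q q1]; first exact: quotient_group_semitopological.
have Hq : ~ normal_set H (repr q).
  move=> Hq; apply: q1; apply: subset_closure; rewrite /= -[q]reprK.
  by apply/quotient_groupP; rewrite invg1 mul1g.
have [W [W1 HW]] := compact_set_power_disjoint Gn T1 cH Hq.
exists (\pi_(quotient_group H) @` W); split; first exact: nbhs_image_pi.
move=> /set_power_image_pi [p Wp]; rewrite -[q]reprK => /quotient_groupP Hp.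
(* With [k = p^-1 * repr q] in [H], [repr q * k^-1] is [p], which lies in [set_power W n]. *)
by apply: (HW _ Hp); rewrite invgM invgK mulVKg.
Qed.
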